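(* Let $q\ge 2$ be an integer, let $\gamma\in[0,q-1]$ and $\delta\in[0,1-\frac1q]$, and let $\mathcal{C}$ be a family of $q$-ary codes that is $(\gamma,\delta)$-list-decodable, i.e., list-decodable from a $\gamma$ fraction of insertions and a $\delta$ fraction of deletions. Put $d=\lfloor \delta q\rfloor$ and $\alpha = 1-\delta q+d$. Then for all real $\gamma_0,\gamma_1\ge 0$ satisfying $$\alpha\left(1-\tfrac{d}{q}\right)\gamma_0+(1-\alpha)\left(1-\tfrac{d+1}{q}\right)\gamma_1=\gamma,$$ the rate of $\mathcal{C}$ is no larger than $$\alpha\left(1-\frac{d}{q}\right)\left((1+\gamma_0)\log_q\frac{q-d}{1+\gamma_0}-\gamma_0\log_q\frac{q-d-1}{\gamma_0}\right)+(1-\alpha)\left(1-\frac{d+1}{q}\right)\left((1+\gamma_1)\log_q\frac{q-d-1}{1+\gamma_1}-\gamma_1\log_q\frac{q-d-2}{\gamma_1}\right).$$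
   Context: A $q$-ary insertion-deletion code of block length $n$ is a set $C\subseteq\Sigma^n$ with $|\Sigma|=q$. For $\gamma,\delta\ge 0$, it is $(\gamma,\delta,L)$-list-decodable if there is a function $D:\Sigma^*\to 2^C$ with $|D(w)|\le L$ for every $w\in\Sigma^*$, such that for every $x\in C$ and every word $w$ obtained from $x$ by at most $\gamma n$ insertions and at most $\delta n$ deletions, $x\in D(w)$. A family of $q$-ary codes $\mathcal{C}$ consists of codes $C_n$ with increasing block lengths $n$ (over an infinite set of lengths); it is $(\gamma,\delta)$-list-decodable if there is a polynomial function $L(\cdot)$ such that each $C_n$ is $(\gamma,\delta,L(n))$-list-decodable. The rate of the family is $R=\lim_{n\to\infty}\frac{\log_q|C_n|}{n}$. Conventions for degenerate values: a term $\gamma_j\log_q\frac{m}{\gamma_j}$ is $0$ when $\gamma_j=0$ (whatever $m$ is); for $\gamma_j>0$ and $m=0$ one has $-\gamma_j\log_q\frac{0}{\gamma_j}=+\infty$; and the second summand is $0$ when $1-\alpha=0$. *)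

(* Defs.v *)
From HB Require Import structures.
From mathcomp Require Import all_boot all_order all_algebra.
From mathcomp Require Import all_classical all_reals all_analysis.

Set Implicit Arguments.
Unset Strict Implicit.
Unset Printing Implicit Defensive.

Import Order.TTheory GRing.Theory Num.Theory.
Import numFieldNormedType.Exports.

Local Open Scope classical_set_scope.
Local Open Scope ring_scope.

(* [indel x i j w]: [w] is obtained from [x] by a sequence of single-symbol
   edits, in any order, consisting of [i] insertions and [j] deletions. *)
Inductive indel (T : Type) (x : seq T) : nat -> nat -> seq T -> Prop :=
| indel_refl : indel x 0 0 x
| indel_ins i j (u v : seq T) (a : T) :
    indel x i j (u ++ v) -> indel x i.+1 j (u ++ a :: v)
| indel_del i j (u v : seq T) (a : T) :
    indel x i j (u ++ a :: v) -> indel x i j.+1 (u ++ v).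

Definition corruptible (R : realType) (T : Type) (n : nat) (gamma delta : R)
    (x : n.-tuple T) (w : seq T) : Prop :=
  exists i j : nat,
    [/\ i%:R <= gamma * n%:R, j%:R <= delta * n%:R & indel x i j w].

Definition list_decodable (R : realType) (Sigma : finType) (n : nat)
    (gamma delta L : R) (C : {set n.-tuple Sigma}) : Prop :=
  exists D : seq Sigma -> {set n.-tuple Sigma},
    [/\ forall w, D w \subset C,
        forall w, #|D w|%:R <= L
      & forall (x : n.-tuple Sigma) (w : seq Sigma),
          x \in C -> corruptible gamma delta x w -> x \in D w].

(* The infinite set of block lengths is given by its increasing enumeration. *)
Record code_family (Sigma : finType) := CodeFamily {
  block_length : nat -> nat;
  block_length_incr : {homo block_length : k l / (k < l)%N};
  code : forall k : nat, {set (block_length k).-tuple Sigma}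
}.

Definition family_list_decodable (R : realType) (Sigma : finType)
    (gamma delta : R) (F : code_family Sigma) : Prop :=
  exists L : {poly R}, forall k : nat,
    list_decodable gamma delta L.[(block_length F k)%:R] (code F k).

Definition logb (R : realType) (q : nat) (x : R) : R := ln x / ln q%:R.

(* Since [ln 0 = 0], an empty code contributes the same term as a code with
   one word. *)
Definition is_rate (R : realType) (Sigma : finType) (F : code_family Sigma)
    (r : R) : Prop :=
  (logb #|Sigma| #|code F k|%:R / (block_length F k)%:R : R) @[k --> \oo] --> r.

(* [- g * log_q (m / g)], taken to be [0] when [g = 0] and [+oo] when
   [m = 0 < g]. *)
Definition neg_log_term (R : realType) (q : nat) (m g : R) : \bar R :=
  if g == 0 then 0%E
  else if m == 0 then +oo%E
  else (- (g * logb q (m / g)))%:E.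

(* In [\bar R], [0 * +oo = 0], so the summand vanishes when [c = 0]. *)
Definition bound_summand (R : realType) (q : nat) (c m g : R) : \bar R :=
  (c%:E * (((1 + g) * logb q (m / (1 + g)))%:E + neg_log_term q (m - 1) g))%E.

(* Main.v *)
Require Import Defs.
From mathcomp Require Import all_boot all_order all_algebra.
From mathcomp Require Import all_classical all_reals all_analysis.
From mathcomp Require Import zify ring lra.

(** The adversary cuts a codeword into blocks of lengths about [alpha * n] and
    [(1 - alpha) * n] and keeps in them only the [q - d], respectively [q - d - 1],
    most frequent letters; this costs at most [delta * n] deletions and leaves
    blocks of lengths [l0] and [l1]. The number of words of length [l + i] over [k]
    letters that contain a given word of length [l] is at least
    ['C(l + i, l) * (k - 1) ^ i], whatever the given word. Counting in two ways the
    pairs of a codeword and a word [w0 ++ w1] over small alphabets reachable from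
    it bounds the size of the code by the list size times, up to a constant, the
    inverse of the proportion of superwords in each block; the exponential rate
    of these proportions follows from Stirling-type bounds on factorials. *)

Import Order.TTheory GRing.Theory Num.Theory.
Local Open Scope ring_scope.

(** * Edits, superwords and the double counting *)

Section Combinatorics.
Set Implicit Arguments.
Unset Strict Implicit.
Local Open Scope nat_scope.

(** The prefix [u] is the part already treated, so that the induction can follow the greedy
    recursion of [subseq]; each unmatched letter of [w] costs one insertion. *)
Lemma indel_insert (T : eqType) (x : seq T) (i j : nat) (u y w : seq T) :
  subseq y w -> indel x i j (u ++ y) -> indel x (i + (size w - size y)) j (u ++ w).
Proof.
elim: w i u y => [|b w IH] i u y.
  by rewrite subseq0 => /eqP -> /=; rewrite addn0.
case: y => [_|a y /=].
  move=> H; have := @indel_ins _ _ _ _ _ _ b H.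
  rewrite -cat_rcons => /(IH _ _ [::] (sub0seq _)).
  by rewrite cat_rcons addSnnS /= !subn0.
case: eqP => [-> sub|_ sub H].
  by rewrite -!cat_rcons subSS; exact: IH.
have := @indel_ins _ _ _ _ _ _ b H.
rewrite -cat_rcons => /(IH _ _ _ sub).
have := size_subseq sub => /= sz.
by rewrite cat_rcons addSnnS subSn.
Qed.

Lemma indel_delete (T : eqType) (x : seq T) (i j : nat) (u y w : seq T) :
  subseq y w -> indel x i j (u ++ w) -> indel x i (j + (size w - size y)) (u ++ y).
Proof.
elim: w j u y => [|b w IH] j u y.
  by rewrite subseq0 => /eqP -> /=; rewrite addn0.
case: y => [_|a y /=].
  move=> H; have := @indel_del _ _ _ _ _ _ _ H.
  by move=> /(IH _ _ [::] (sub0seq _)); rewrite addSnnS /= !subn0.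
case: eqP => [-> sub|_ sub H].
  by rewrite -!cat_rcons subSS; exact: IH.
have := @indel_del _ _ _ _ _ _ _ H => /(IH _ _ _ sub).
have := size_subseq sub => /= sz.
by rewrite addSnnS subSn.
Qed.

Fixpoint words (T : Type) (s : seq T) (m : nat) : seq (seq T) :=
  if m is m'.+1 then [seq a :: w | a <- s, w <- words s m'] else [:: [::]].

Lemma size_words (T : Type) (s : seq T) m : size (words s m) = size s ^ m.
Proof. by elim: m => //= m IH; rewrite size_allpairs IH expnS. Qed.

Lemma mem_words_size (T : eqType) (s : seq T) m w : w \in words s m -> size w = m.
Proof.
elim: m w => [|m IH] w /=; first by rewrite inE => /eqP ->.
by case/allpairsP => [[a v]] /= [_ /IH <- ->].
Qed.

(* The number of words containing [y] depends only on the size of [y]; splitting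
   on the first letter turns the estimate into Pascal's rule. *)
Lemma count_superwords (T : eqType) (s : seq T) (m : nat) (y : seq T) :
  uniq s -> all (mem s) y ->
  'C(m, size y) * (size s).-1 ^ (m - size y) <= count (subseq y) (words s m).
Proof.
move=> us; elim: m y => [|m IH] [|a y] //=.
  move=> _; rewrite bin0 mul1n subn0.
  rewrite (eq_count (a2 := predT)) => [|w]; last exact: sub0seq.
  by rewrite count_predT size_allpairs size_words -expnS leq_exp2r ?leq_pred.
case/andP=> sa sy; rewrite subSS binS.
rewrite count_flatten sumnE -map_comp big_map.
(* Words starting with [a] need only contain [y] in their tail, while each of the other
   [(size s).-1] first letters leaves all of [a :: y] to the tail. *)
rewrite (perm_big _ (perm_to_rem sa)) big_cons /= count_map.
rewrite (eq_count (a2 := subseq y)) => [|w] /=; last by rewrite eqxx.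
rewrite addnC mulnDl leq_add ?IH //.
rewrite (eq_big_seq (fun=> count (subseq (a :: y)) (words s m))); last first.
  move=> b; rewrite mem_rem_uniq // inE => /andP[ba _] /=.
  rewrite count_map; apply: eq_count => w /=.
  by rewrite eq_sym (negPf ba).
rewrite big_const_seq count_predT iter_addn_0 size_rem //.
have [lt|ge] := ltnP (size y) m; last by rewrite bin_small.
have -> : m - size y = (m - (size y).+1).+1 by lia.
rewrite expnSr mulnA leq_mul2r; apply/orP; right.
by have := IH (a :: y); rewrite /= sa => /(_ sy).
Qed.

(** Start from the full alphabet and remove a least frequent letter at each step: the mean number of
    occurrences per remaining letter never drops below [size x / #|T|]. *)
Lemma frequent_letters (T : finType) (x : seq T) (k : nat) : k <= #|T| ->
  exists2 S : {set T}, #|S| = k & size x * k <= count (mem S) x * #|T|.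
Proof.
move=> /subnKC; elim: (#|T| - k) {-2}k => [|r IH] {}k kr.
  exists [set: T]; first by rewrite cardsT; lia.
  by rewrite (eq_count (a2 := predT)) ?count_predT => [|z]; [nia | rewrite /= inE].
have [|S cS lS] := IH k.+1; first by lia.
have cntE (A : {set T}) : count (mem A) x = \sum_(t in A) count_mem t x.
  elim: x {lS IH} => [|z x IHx] /=; first by rewrite big1.
  rewrite IHx big_split /=; congr (_ + _).
  case: (boolP (z \in A)) => zA.
    rewrite (bigD1 z) //= eqxx big1 // => t /andP[_ /negPf].
    by rewrite eq_sym => ->.
  rewrite big1 // => t tA; case: eqP => // zt; by rewrite zt tA in zA.
have /card_gt0P[t0 t0S] : 0 < #|S| by rewrite cS.
pose t := [arg min_(t < t0 in S) count_mem t x].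
have [tS tmin] : t \in S /\ forall s, s \in S -> count_mem t x <= count_mem s x.
  by rewrite /t; case: arg_minnP.
exists (S :\ t); first by have := cardsD1 t S; rewrite tS cS; lia.
have := cntE S; rewrite (big_setD1 t) //= -cntE => cS1.
have : k.+1 * count_mem t x <= count (mem S) x.
  rewrite cntE -cS -sum_nat_const; exact: leq_sum.
rewrite cS1 in lS *; move: lS.
set f := count_mem t x; set c := count _ x => lS hf.
have hc : c * k.+1 >= (f + c) * k by lia.
rewrite -(leq_pmul2r (ltn0Sn k)).
apply: (@leq_trans ((f + c) * #|T| * k)); first by rewrite mulnAC leq_mul2r lS orbT.
by rewrite mulnAC [leqRHS]mulnAC leq_mul2r hc orbT.
Qed.

(** The hypothesis on [l] says that [l] is at most the ceiling of [a * k / #|T|], the number of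
    letters that a suitable [k]-letter alphabet is sure to keep. As [W] must not depend on [x], it
    gathers the words over all such alphabets, at the constant cost [2 ^ #|T|]. *)
Lemma block_covering (T : finType) (a k l i : nat) :
  k <= #|T| -> l * #|T| < a * k + #|T| ->
  exists2 W : seq (seq T),
    size W <= 2 ^ #|T| * k ^ (l + i) &
    forall x : seq T, size x = a -> exists2 y,
      subseq y x && (size y == l) &
      'C(l + i, l) * k.-1 ^ i
        <= count (fun w => (size w == l + i) && subseq y w) W.
Proof.
move=> kT lak.
pose P := enum [set S : {set T} | #|S| == k].
exists (flatten [seq words (enum (A : {set T})) (l + i) | A <- P]).
  rewrite size_flatten sumnE big_map big_map.
  rewrite (eq_big_seq (fun=> k ^ (l + i))); last first.
    by move=> S; rewrite mem_enum inE size_words -cardE => /eqP ->.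
  rewrite big_const_seq count_predT iter_addn_0 mulnC leq_mul2r.
  have := max_card [set A : {set T} | #|A| == k].
  by rewrite -cardE -cardsT -powersetT card_powerset cardsT => ->; rewrite orbT.
move=> x sx; have [S cS lS] := frequent_letters x kT.
have ll : l <= count (mem S) x by rewrite sx in lS; nia.
exists (take l [seq z <- x | mem S z]).
  rewrite (subseq_trans (take_subseq _ _) (filter_subseq _ _)) /=.
  by rewrite size_takel // size_filter.
have SP : S \in P by rewrite mem_enum inE cS.
rewrite count_flatten sumnE big_map big_map (perm_big _ (perm_to_rem SP)) big_cons.
(* The words over [S] alone already reach the required count. *)
apply: leq_trans (leq_addr _ _).
have sy : size (take l [seq z <- x | mem S z]) = l by rewrite size_takel // size_filter.
have := @count_superwords T (enum S) (l + i) (take l [seq z <- x | mem S z]) (enum_uniq _).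
rewrite sy addKn -cardE cS => H.
rewrite (@eq_in_count _ _ (subseq (take l [seq z <- x | mem S z]))); last first.
  by move=> w /mem_words_size ->; rewrite eqxx.
apply: H; apply/allP => z /mem_take; rewrite mem_filter => /andP[/= zS _].
by rewrite mem_enum.
Qed.

Lemma count_allpairs_cat (T : eqType) (A B P : pred (seq T)) (s t : seq (seq T)) :
  (forall u v, A u -> B v -> P (u ++ v)) ->
  count A s * count B t <= count P [seq u ++ v | u <- s, v <- t].
Proof.
move=> AB; elim: s => //= u s IH; rewrite count_cat mulnDl leq_add //.
case: (boolP (A u)) => Au; last by rewrite mul0n.
by rewrite mul1n count_map; apply: sub_count => v Bv /=; exact: AB.
Qed.

Lemma list_size_bound (T : finType) (n a k0 k1 l0 l1 i0 i1 M : nat)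
    (C : {set n.-tuple T}) (D : seq T -> {set n.-tuple T}) :
  a <= n -> k0 <= #|T| -> k1 <= #|T| ->
  l0 * #|T| < a * k0 + #|T| -> l1 * #|T| < (n - a) * k1 + #|T| ->
  (forall w, #|D w| <= M) ->
  (forall (x : n.-tuple T) w, x \in C ->
    indel x (i0 + i1) (n - (l0 + l1)) w -> x \in D w) ->
  #|C| * (('C(l0 + i0, l0) * k0.-1 ^ i0) * ('C(l1 + i1, l1) * k1.-1 ^ i1))
    <= (2 ^ #|T| * k0 ^ (l0 + i0)) * (2 ^ #|T| * k1 ^ (l1 + i1)) * M.
Proof.
move=> an k0T k1T hl0 hl1 DM CD.
have [W0 sW0 cW0] := block_covering i0 k0T hl0.
have [W1 sW1 cW1] := block_covering i1 k1T hl1.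
pose W := [seq u ++ v | u <- W0, v <- W1].
apply: (@leq_trans (\sum_(w <- W) #|D w|)); last first.
  apply: (@leq_trans (\sum_(w <- W) M)); first exact: leq_sum.
  rewrite big_const_seq count_predT iter_addn_0 mulnC size_allpairs.
  by rewrite leq_mul2r leq_mul ?orbT.
(* The pairs counted are those of [x] in [C] and [w] in [W] with [x \in D w]. A list may here
   contain words outside [C], hence an inequality. *)
apply: (@leq_trans (\sum_(w <- W) \sum_(x in C) (x \in D w))); last first.
  apply: leq_sum => w _; rewrite -sum1_card big_mkcond [leqRHS]big_mkcond /=.
  by apply: leq_sum => x _; case: (x \in C); case: (x \in D w).
rewrite exchange_big /= -sum_nat_const; apply: leq_sum => x xC.
have [|y0 /andP[y0x /eqP sy0] cy0] := cW0 (take a x).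
  by rewrite size_takel ?size_tuple.
have [|y1 /andP[y1x /eqP sy1] cy1] := cW1 (drop a x).
  by rewrite size_drop size_tuple.
apply: leq_trans (leq_mul cy0 cy1) _.
rewrite (_ : \sum_(w <- W) _ = count (fun w => x \in D w) W); last first.
  by rewrite -sum1_count [RHS]big_mkcond; apply: eq_bigr => w _; case: (_ \in _).
apply: count_allpairs_cat => u v /andP[/eqP su y0u] /andP[/eqP sv y1v].
apply: CD => //.
(* The edits first delete from [x] down to [y0 ++ y1], then insert up to [u ++ v]. *)
have yx : subseq (y0 ++ y1) x by rewrite -(cat_take_drop a x) cat_subseq.
have yw : subseq (y0 ++ y1) (u ++ v) by rewrite cat_subseq.
have := @indel_delete _ x 0 0 [::] _ _ yx (indel_refl _).
move=> /(@indel_insert _ x 0 _ [::] _ _ yw).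
rewrite !size_cat su sv sy0 sy1 size_tuple !add0n /=.
by have -> : l0 + i0 + (l1 + i1) - (l0 + l1) = i0 + i1 by lia.
Qed.

End Combinatorics.

(** * Entropy estimates from elementary bounds on the logarithm *)

Section Entropy.
Set Implicit Arguments.
Unset Strict Implicit.
Import numFieldNormedType.Exports.
Local Open Scope classical_set_scope.
Context {R : realType}.
Implicit Types x y : R.

(** The entropy summand up to sign. As [ln 0 = 0], its value at [0] is its limit there, so limits
    can also be taken at vanishing proportions. *)
Definition xlnx x : R := x * ln x.

Lemma ln_ge_1BV x : 0 < x -> 1 - x^-1 <= ln x.
Proof.
move=> x0; have := @le_ln1Dx R (x^-1 - 1); rewrite addrCA subrr addr0.
rewrite lnV ?posrE// => /(_ _)/wrap[]; first by rewrite ltrBrDl subrr invr_gt0.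
lra.
Qed.

(** Sublinearity of [ln] at the square root yields a power of [x] below one, enough for [ln l / n]
    to vanish when [l] is of order [n]. *)
Lemma ln_le_2sqrt x : ln x <= 2 * Num.sqrt x.
Proof.
have [x0|x0] := leP x 0; first by rewrite ln0// mulr_ge0 ?sqrtr_ge0.
have s0 : 0 < Num.sqrt x by rewrite sqrtr_gt0.
rewrite -{1}(sqr_sqrtr (ltW x0)) lnXn// mulr2n.
have := ln_sublinear s0; lra.
Qed.

Lemma xlnx_continuous_ge0 x : 0 <= x -> {for x, continuous xlnx}.
Proof.
rewrite le_eqVlt => /predU1P[<-|x0]; last first.
  by apply: cvgM; [exact: cvg_id|exact: continuous_ln].
(* The square root controls the negative values, through [1 - s^-1 <= ln s] at [s = Num.sqrt y]; the
   quadratic term controls the positive ones, through [ln y < y]. *)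
have bnd y : `|xlnx y| <= 2 * Num.sqrt y + 4 * `|y| * `|y|.
  have [y0|y0] := leP y 0.
    rewrite /xlnx ln0// mulr0 normr0 addr_ge0 ?mulr_ge0 ?sqrtr_ge0//.
  have s0 : 0 < Num.sqrt y by rewrite sqrtr_gt0.
  have lo := @ln_ge_1BV _ s0.
  have hi := @ln_sublinear _ _ y0.
  have ey : Num.sqrt y ^+ 2 = y by rewrite sqr_sqrtr// ltW.
  have el : ln y = 2 * ln (Num.sqrt y).
    by rewrite -{1}ey lnXn// mulr2n; ring.
  have lb : - (2 * Num.sqrt y) <= xlnx y.
    rewrite /xlnx el -{2}ey.
    have -> : - (2 * Num.sqrt y) = Num.sqrt y ^+ 2 * (2 * (- (Num.sqrt y)^-1)).
      by field; rewrite gt_eqF.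
    by rewrite ler_pM2l ?exprn_gt0// ler_pM2l//; lra.
  rewrite (gtr0_norm y0) ler_norml; apply/andP; split; first by nra.
  rewrite /xlnx; nra.
have sq0 : Num.sqrt y @[y --> (0:R)] --> (0:R).
  by rewrite -[X in _ --> X]sqrtr0; exact: sqrt_continuous.
have b0 : 2 * Num.sqrt y + 4 * `|y| * `|y| @[y --> (0:R)] --> (0:R).
  rewrite [X in _ --> X](_ : 0 = 2 * 0 + 4 * `|0 : R| * `|0 : R|); last first.
    by rewrite normr0 !mulr0 addr0.
  apply: cvgD; first by apply: cvgM => //; exact: cvg_cst.
  by apply: cvgM; [apply: cvgM; [exact: cvg_cst|]|];
    apply: cvg_norm; exact: cvg_id.
suff H : xlnx y @[y --> (0:R)] --> xlnx 0 by exact: H.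
rewrite {2}/xlnx mul0r.
apply/norm_cvg0P; apply: squeeze_cvgr (cvg_cst 0) b0.
by near=> y; rewrite normr_ge0 bnd.
Unshelve. all: by end_near. Qed.
Lemma xlnx0 : xlnx 0 = 0. Proof. by rewrite /xlnx mul0r. Qed.

Lemma xlnxM x y : 0 <= x -> 0 < y -> xlnx (y * x) = y * xlnx x + y * x * ln y.
Proof.
rewrite le_eqVlt => /predU1P[<-|x0] y0; first by rewrite mulr0 mul0r xlnx0 mulr0 addr0.
by rewrite /xlnx lnM// mulrDr addrC !mulrA.
Qed.

(** These are the increments behind the two Stirling-type bounds: the second inequality drives the
    induction for [ln_fact_ge], the first the one for [ln_fact_le]. *)
Lemma ln_succ (n : nat) : (0 < n)%N ->
  n.+1%:R^-1 <= ln n.+1%:R - ln n%:R :> R /\ n%:R * (ln n.+1%:R - ln n%:R) <= 1 :> R.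
Proof.
move=> n0; have n0' : 0 < n%:R :> R by rewrite ltr0n.
have s0 : 0 < n.+1%:R :> R by rewrite ltr0n.
rewrite -ln_div//; split.
  apply: le_trans (ln_ge_1BV (divr_gt0 s0 n0')).
  by rewrite le_eqVlt; apply/orP; left; apply/eqP; rewrite -natr1 in s0 *; field; rewrite !gt_eqF.
have -> : n.+1%:R / n%:R = 1 + n%:R^-1 :> R by rewrite -natr1; field; rewrite gt_eqF.
rewrite mulrC -ler_pdivlMr// div1r; apply: le_ln1Dx.
by apply: (@lt_trans _ _ 0); rewrite ?invr_gt0// oppr_lt0.
Qed.

Lemma ln_factS (n : nat) : ln n.+1`!%:R = ln n.+1%:R + ln n`!%:R :> R.
Proof. by rewrite factS natrM lnM// posrE ltr0n ?fact_gt0. Qed.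

Lemma ln_fact_ge (n : nat) : xlnx n%:R - n%:R <= ln n`!%:R :> R.
Proof.
elim: n => [|[|n] IH]; first by rewrite xlnx0 subr0 ln1.
  by rewrite /xlnx ln1 mulr0 sub0r lerN10.
rewrite ln_factS; have [_] := @ln_succ n.+1 isT.
by move: IH; rewrite /xlnx -[n.+2%:R]natr1; nra.
Qed.

(* Also true for [n = 0], as [ln 0 = 0]. *)
Lemma ln_fact_le (n : nat) : ln n`!%:R <= xlnx n%:R - n%:R + ln n%:R + 1 :> R.
Proof.
elim: n => [|[|n] IH]; first by rewrite xlnx0 ln1 ln0//; lra.
  by rewrite /xlnx ln1 mulr0; lra.
rewrite ln_factS; have [+ _] := @ln_succ n.+1 isT.
rewrite -div1r ler_pdivrMr ?ltr0n//.
by move: IH; rewrite /xlnx -[n.+2%:R]natr1; nra.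
Qed.

(** In the quotient of factorials the linear Stirling terms cancel, which leaves an entropy with a
    logarithmic error. *)
Lemma ln_bin_ge (l i : nat) :
  xlnx (l + i)%:R - xlnx l%:R - xlnx i%:R - ln l%:R - ln i%:R - 2
    <= ln 'C(l + i, l)%:R :> R.
Proof.
have := bin_fact (leq_addr i l); rewrite addKn => /(congr1 (fun k => ln k%:R : R)).
rewrite !natrM !lnM ?posrE ?mulr_gt0 ?ltr0n ?fact_gt0 ?bin_gt0 ?leq_addr//.
have := ln_fact_ge (l + i); have := ln_fact_le l; have := ln_fact_le i.
rewrite natrD; lra.
Qed.

(** * Limits along a sequence of block lengths *)

Section Limits.
Variable n : nat -> nat.
Hypothesis n_gt0 : forall k, (0 < n k)%N.
Hypothesis n_oo : (n k)%:R^-1 @[k --> \oo] --> (0 : R).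

Let nR_gt0 k : 0 < (n k)%:R :> R. Proof. by rewrite ltr0n. Qed.

(** Since [ln l <= 2 * Num.sqrt l], the quotient is squeezed below twice the square root of
    [l / n * n^-1]. *)
Lemma cvg_ln_over (l : nat -> nat) (c : R) :
  (l k)%:R / (n k)%:R @[k --> \oo] --> c ->
  ln (l k)%:R / (n k)%:R @[k --> \oo] --> (0 : R).
Proof.
move=> lc.
have ub : 2 * Num.sqrt ((l k)%:R / (n k)%:R * (n k)%:R^-1) @[k --> \oo] --> (0 : R).
  rewrite -(mulr0 2) -sqrtr0 -(mulr0 c).
  apply: cvgM; first exact: cvg_cst.
  apply: (@continuous_cvg _ _ _ _ _ _ (@Num.sqrt R)); first exact: sqrt_continuous.
  exact: cvgM.
apply: squeeze_cvgr (cvg_cst 0) ub; near=> k.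
apply/andP; split.
  have [->|l0] := posnP (l k); first by rewrite ln0 ?mul0r.
  by rewrite divr_ge0// ln_ge0// ler1n.
rewrite -mulrA -invfM -expr2 sqrtrM ?ler0n// sqrtrV ?sqr_ge0//.
rewrite sqrtr_sqr gtr0_norm// mulrA ler_pM2r ?invr_gt0//; exact: ln_le_2sqrt.
Unshelve. all: by end_near. Qed.

Lemma cvg_xlnx (l : nat -> nat) (c : R) :
  (l k)%:R / (n k)%:R @[k --> \oo] --> c ->
  xlnx ((l k)%:R / (n k)%:R) @[k --> \oo] --> xlnx c.
Proof.
move=> lc; have c0 : 0 <= c.
  by apply: (ler_cvg_to (cvg_cst 0) lc); near=> k; rewrite divr_ge0.
by apply: continuous_cvg lc; exact: xlnx_continuous_ge0.
Unshelve. all: by end_near. Qed.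

Lemma cvg_truncn (x : R) : 0 <= x ->
  (Num.truncn (x * (n k)%:R))%:R / (n k)%:R @[k --> \oo] --> x.
Proof.
move=> x0; have lb : x - (n k)%:R^-1 @[k --> \oo] --> x.
  by rewrite -[X in _ --> X]subr0; apply: cvgB => //; exact: cvg_cst.
apply: squeeze_cvgr lb (cvg_cst x); near=> k.
have /truncn_itv/andP[lo hi] : 0 <= x * (n k)%:R by rewrite mulr_ge0.
rewrite ler_pdivlMr// ler_pdivrMr// lo andbT mulrBl mulVf ?gt_eqF//.
by rewrite lerBlDr natr1 ltW.
Unshelve. all: by end_near. Qed.

(** The integer quotient is the ceiling of [a k * j / p], so the rounding error disappears after
    division by [n k]. *)
Lemma cvg_ceil_div (a : nat -> nat) (x : R) (j p : nat) : (0 < p)%N ->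
  (a k)%:R / (n k)%:R @[k --> \oo] --> x ->
  ((a k * j + p.-1) %/ p)%N%:R / (n k)%:R @[k --> \oo] --> x * (j%:R / p%:R).
Proof.
move=> p0 ax; have p0' : 0 < p%:R :> R by rewrite ltr0n.
have lb : (a k)%:R / (n k)%:R * (j%:R / p%:R) @[k --> \oo] --> x * (j%:R / p%:R).
  by apply: cvgM => //; exact: cvg_cst.
have ub : (a k)%:R / (n k)%:R * (j%:R / p%:R) + (n k)%:R^-1 @[k --> \oo]
    --> x * (j%:R / p%:R).
  by rewrite -[X in _ --> X]addr0; apply: cvgD.
apply: squeeze_cvgr lb ub; near=> k.
set t := (_ %/ p)%N.
have [lo hi] : (a k)%:R * j%:R <= t%:R * p%:R :> R /\
    t%:R * p%:R <= (a k)%:R * j%:R + p%:R :> R.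
  have e := divn_eq (a k * j + p.-1) p; have r := ltn_pmod (a k * j + p.-1) p0.
  by rewrite -!natrM -natrD !ler_nat -/t; rewrite -/t in e; split; lia.
have -> : (a k)%:R / (n k)%:R * (j%:R / p%:R) = (a k)%:R * j%:R / p%:R / (n k)%:R :> R.
  by field; rewrite !gt_eqF.
rewrite -[X in _ / _ + X]div1r -mulrDl !ler_pM2r ?invr_gt0//.
rewrite ler_pdivrMr// lo /= -(ler_pM2r p0') mulrDl divfK ?gt_eqF//.
by rewrite mul1r.
Unshelve. all: by end_near. Qed.

(* For [p = q - 1], a lower bound for the logarithm of the probability that a
   uniform word of length [l + i] over [q] letters contains a given word of
   length [l]. *)
Definition ln_superword_prob (l i p q : nat) : R :=
  ln ('C(l + i, l) * p ^ i)%:R - (l + i)%:R * ln q%:R.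

(** The minorant [f] is the bound of [ln_bin_ge] rewritten in the proportions [l / n] and [i / n];
    its limit follows from the continuity of [xlnx], also at [0]. *)
Lemma superword_rate (l i : nat -> nat) (c g : R) (p q : nat) :
  (l k)%:R / (n k)%:R @[k --> \oo] --> c ->
  (i k)%:R / (n k)%:R @[k --> \oo] --> c * g ->
  0 <= c -> 0 <= g ->
  (forall k, (0 < p)%N || (i k == 0)%N) ->
  exists2 f : nat -> R,
    f k @[k --> \oo] -->
      c * ((1 + g) * ln (1 + g) - g * ln g + g * ln p%:R - (1 + g) * ln q%:R) &
    forall k, (n k)%:R * f k <= ln_superword_prob (l k) (i k) p q.
Proof.
move=> lc ic c0 g0 pi.
have mc : (l k + i k)%N%:R / (n k)%:R @[k --> \oo] --> c * (1 + g).
  rewrite mulrDr mulr1; under eq_fun do rewrite natrD mulrDl.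
  exact: cvgD.
exists (fun k => xlnx ((l k + i k)%N%:R / (n k)%:R) - xlnx ((l k)%:R / (n k)%:R)
  - xlnx ((i k)%:R / (n k)%:R) - ln (l k)%:R / (n k)%:R - ln (i k)%:R / (n k)%:R
  - 2 * (n k)%:R^-1 + (i k)%:R / (n k)%:R * ln p%:R - (l k + i k)%N%:R / (n k)%:R * ln q%:R).
  have -> : c * ((1 + g) * ln (1 + g) - g * ln g + g * ln p%:R - (1 + g) * ln q%:R)
    = xlnx (c * (1 + g)) - xlnx c - xlnx (c * g) - 0 - 0 - 2 * 0 + c * g * ln p%:R
      - c * (1 + g) * ln q%:R.
    move: c0; rewrite le_eqVlt => /predU1P[<-|c0]; first by rewrite !mul0r xlnx0; ring.
    rewrite !xlnxM//; last by lra.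
    by rewrite /xlnx; ring.
  apply: cvgB; last by apply: cvgM => //; exact: cvg_cst.
  apply: cvgD; last by apply: cvgM => //; exact: cvg_cst.
  apply: cvgB; last by apply: cvgM => //; exact: cvg_cst.
  apply: cvgB; last exact: cvg_ln_over ic.
  apply: cvgB; last exact: cvg_ln_over lc.
  apply: cvgB; last exact: cvg_xlnx.
  by apply: cvgB; exact: cvg_xlnx.
move=> k.
(* Rescaling produces multiples of [ln (n k)], which cancel because the proportions of [l] and [i]
   add up to that of [l + i]. *)
have scale (j : nat) : (n k)%:R * xlnx (j%:R / (n k)%:R) = xlnx j%:R - j%:R * ln (n k)%:R.
  have e : j%:R = (n k)%:R * (j%:R / (n k)%:R) :> R by field; rewrite gt_eqF.
  by rewrite [in RHS]e (@xlnxM (j%:R / (n k)%:R)) ?divr_ge0// addrK.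
have npk : (n k)%:R != 0 :> R by rewrite gt_eqF.
have -> : ln_superword_prob (l k) (i k) p q =
  ln 'C(l k + i k, l k)%:R + (i k)%:R * ln p%:R - (l k + i k)%:R * ln q%:R.
  rewrite /ln_superword_prob; congr (_ - _).
  have C0 : (0 < 'C(l k + i k, l k))%N by rewrite bin_gt0 leq_addr.
  have /orP[p0|/eqP ->] := pi k; last by rewrite expn0 muln1 mul0r addr0.
  by rewrite natrM lnM ?posrE ?ltr0n ?expn_gt0 ?p0// natrX lnXn ?ltr0n// [in RHS]mulr_natl.
have := ln_bin_ge (l k) (i k).
rewrite !(mulrDr, mulrBr, mulrN) !scale.
rewrite natrD.
rewrite (_ : (n k)%:R * (ln (l k)%:R / (n k)%:R) = ln (l k)%:R); last by field.
rewrite (_ : (n k)%:R * (ln (i k)%:R / (n k)%:R) = ln (i k)%:R); last by field.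
rewrite (_ : (n k)%:R * (2 * (n k)%:R^-1) = 2); last by field.
rewrite (_ : (n k)%:R * ((i k)%:R / (n k)%:R * ln p%:R) = (i k)%:R * ln p%:R); last by field.
rewrite (_ : (n k)%:R * (((l k)%:R + (i k)%:R) / (n k)%:R * ln q%:R)
  = ((l k)%:R + (i k)%:R) * ln q%:R); last by field.
lra.
Qed.

(** A polynomial list size is at most [A * n ^ size L], so its logarithm is of order [ln n] and
    costs no rate. *)
Lemma ln_poly_rate (L : {poly R}) :
  exists2 f : nat -> R, f k @[k --> \oo] --> (0 : R) &
  forall k, ln (Num.max 1 L.[(n k)%:R]) <= (n k)%:R * f k.
Proof.
pose A := 1 + \sum_(j < size L) `|L`_j|.
have A1 : 1 <= A by rewrite lerDl sumr_ge0.
exists (fun k => ln A * (n k)%:R^-1 + (size L)%:R * (ln (n k)%:R / (n k)%:R)).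
  rewrite -[X in _ --> X](_ : ln A * 0 + (size L)%:R * 0 = 0); last by rewrite !mulr0 addr0.
  apply: cvgD; apply: cvgM => //; try exact: cvg_cst.
  apply: (@cvg_ln_over n 1); under eq_fun do rewrite divff ?gt_eqF//.
  exact: cvg_cst.
move=> k; have n1 : 1 <= (n k)%:R :> R by rewrite ler1n.
have le1 : Num.max 1 L.[(n k)%:R] <= A * (n k)%:R ^+ size L.
  rewrite ge_max; apply/andP; split.
    by rewrite mulr_ege1 ?exprn_ege1.
  rewrite horner_coef mulrDl mul1r.
  apply: (@le_trans _ _ (\sum_(j < size L) `|L`_j| * (n k)%:R ^+ size L)).
    apply: ler_sum => j _; apply: le_trans (ler_norm _) _.
    rewrite normrM ler_wpM2l// normrX ger0_norm// ler_weXn2l// ltnW//.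
  by rewrite -mulr_suml lerDr exprn_ge0.
have A0 : 0 < A by lra.
apply: le_trans (_ : ln (A * (n k)%:R ^+ size L) <= _).
  by rewrite ler_ln// posrE ?mulr_gt0 ?exprn_gt0// lt_max ltr01.
rewrite lnM ?posrE ?exprn_gt0// lnXn// -[ln _ *+ _]mulr_natl.
by rewrite le_eqVlt; apply/orP; left; apply/eqP; field; rewrite gt_eqF.
Qed.

End Limits.

End Entropy.

(** * From the counting inequality to the bound on the rate *)

Section Bound.
Set Implicit Arguments.
Unset Strict Implicit.
Import numFieldNormedType.Exports.
Local Open Scope classical_set_scope.
Context {R : realType}.

(* Allows empty codes, whose logarithm is the junk value [ln 0 = 0 = ln 1], to be
   treated as codes with one word. *)
Lemma list_decodable_nonempty (T : finType) (n : nat) (gamma delta L : R)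
    (C : {set n.-tuple T}) : (0 < #|T|)%N -> list_decodable gamma delta L C ->
  exists2 C' : {set n.-tuple T}, #|C'| = maxn 1 #|C| &
    list_decodable gamma delta (Num.max 1 L) C'.
Proof.
move=> /card_gt0P[t _] [D [DC DL CD]].
have [C0|C0] := posnP #|C|.
  exists [set nseq_tuple n t]%SET; first by rewrite cards1 C0.
  exists (fun=> [set nseq_tuple n t]%SET); split=> [w|w|x w ->//] //.
  by rewrite cards1 le_max lexx.
exists C; first by lia.
by exists D; split=> // w; rewrite le_max DL orbT.
Qed.

(** This is the logarithm of [list_size_bound]. The disjunctive hypotheses keep every power
    positive, a zero base being allowed only with exponent [0], so that [ln] splits the products. *)
Lemma ln_size_bound (T : finType) (n a k0 k1 l0 l1 i0 i1 : nat)
    (gamma delta L : R) (C : {set n.-tuple T}) :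
  (0 < #|T|)%N -> list_decodable gamma delta L C ->
  (a <= n)%N -> (k0 <= #|T|)%N -> (k1 <= #|T|)%N ->
  (l0 * #|T| < a * k0 + #|T|)%N -> (l1 * #|T| < (n - a) * k1 + #|T|)%N ->
  (i0 + i1)%:R <= gamma * n%:R -> (n - (l0 + l1))%N%:R <= delta * n%:R ->
  (0 < k0.-1)%N || (i0 == 0)%N -> (0 < k1.-1)%N || (i1 == 0)%N ->
  (0 < k0)%N || (l0 + i0 == 0)%N -> (0 < k1)%N || (l1 + i1 == 0)%N ->
  ln #|C|%:R + ln_superword_prob l0 i0 k0.-1 k0 + ln_superword_prob l1 i1 k1.-1 k1
    <= (#|T| + #|T|)%:R * ln 2 + ln (Num.max 1 L).
Proof.
move=> T0 Cdec an k0T k1T hl0 hl1 ins dels p0 p1 q0 q1.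
have [C' cC' [D [DC DL CD]]] := list_decodable_nonempty T0 Cdec.
have -> : ln #|C|%:R = ln #|C'|%:R :> R.
  by rewrite cC'; have [->|C0] := posnP #|C|;
    [rewrite ln0 ?ln1 | rewrite (maxn_idPr C0)].
have cC0 : (0 < #|C'|)%N by rewrite cC'; lia.
have L1 : 1 <= Num.max 1 L by rewrite le_max lexx.
pose M := Num.truncn (Num.max 1 L).
have M0 : (0 < M)%N by rewrite truncn_gt0.
have DM w : (#|D w| <= M)%N by rewrite truncn_ge_nat//; lra.
have := @list_size_bound T n a k0 k1 l0 l1 i0 i1 M C' D an k0T k1T hl0 hl1 DM.
move=> /(_ _)/wrap[x w xC xw|].
  by apply: CD => //; exists (i0 + i1)%N, (n - (l0 + l1))%N.
have ML : ln M%:R <= ln (Num.max 1 L).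
  by rewrite ler_ln ?posrE ?ltr0n// ?truncn_le; lra.
have pos l i k : (0 < k.-1)%N || (i == 0)%N -> (0 < 'C(l + i, l) * k.-1 ^ i)%N.
  by rewrite muln_gt0 bin_gt0 leq_addr expn_gt0.
have pw m k : (0 < k)%N || (m == 0)%N -> (0 < k ^ m)%N by rewrite expn_gt0.
have lnpw m k : (0 < k)%N || (m == 0)%N -> ln (k ^ m)%:R = m%:R * ln k%:R :> R.
  case/orP=> [k00|/eqP ->]; last by rewrite expn0 ln1 mul0r.
  by rewrite natrX lnXn ?ltr0n// [in RHS]mulr_natl.
have e2 : (0 < 2 ^ #|T|)%N by rewrite expn_gt0.
have P0 := pos l0 _ _ p0; have P1 := pos l1 _ _ p1.
have Q0 := pw _ _ q0; have Q1 := pw _ _ q1.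
rewrite -(ler_nat R) -ler_ln ?posrE ?ltr0n ?muln_gt0 ?e2 ?P0 ?P1 ?Q0 ?Q1 ?cC0 ?M0//; last first.
  by move: P0 P1; rewrite !muln_gt0 => -> ->.
rewrite (natrM _ #|C'|) (natrM _ _ M) [(_ * ('C(_,_) * _))%:R]natrM
  [(2 ^ _ * _ * _)%:R]natrM !(natrM _ (2 ^ _)).
rewrite !lnM ?posrE ?mulr_gt0 ?ltr0n//.
rewrite (lnpw _ _ q0) (lnpw _ _ q1) lnpw// /ln_superword_prob natrD.
lra.
Qed.

(** When finite, the summand is minus the limit exponent of [superword_rate], converted to base
    [q]. *)
Lemma bound_summandE (q K : nat) (c g : R) : 0 <= c -> 0 <= g ->
  (c == 0) || (0 < K)%N -> (c * g == 0) || (1 < K)%N ->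
  bound_summand q c K%:R g
  = (- (c * ((1 + g) * ln (1 + g) - g * ln g + g * ln K.-1%:R - (1 + g) * ln K%:R))
      / ln q%:R)%:E.
Proof.
rewrite /bound_summand => c0 g0 /orP[/eqP -> _|K0].
  by rewrite mul0r oppr0 mul0r mul0e.
case/orP=> [|K1].
  rewrite mulf_eq0 => /orP[/eqP ->|/eqP ->].
    by rewrite mul0r oppr0 mul0r mul0e.
  rewrite /neg_log_term eqxx adde0 -EFinM /logb addr0 ln1 divr1.
  by congr EFin; ring.
rewrite /neg_log_term; case: eqP => [->|/eqP gn0].
  by rewrite adde0 -EFinM /logb addr0 ln1 divr1; congr EFin; ring.
have -> : K%:R - 1 = K.-1%:R :> R by rewrite -[in K%:R](prednK K0) -natr1 addrK.
have K0' : (0 < K.-1)%N by lia.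
rewrite pnatr_eq0 eqn0Ngt K0' /= -EFinD -EFinM /logb !ln_div ?posrE ?ltr0n//.
- by congr EFin; ring.
- by rewrite lt_neqAle eq_sym gn0.
- by lra.
Qed.

(** The hypotheses force [c] and [g] to be positive and [K = 1], where the convention makes the term
    infinite and the bound trivial. *)
Lemma bound_summand_pinfty (q K : nat) (c g : R) : 0 <= c -> 0 <= g ->
  (c == 0) || (0 < K)%N -> ~~ ((c * g == 0) || (1 < K)%N) ->
  bound_summand q c K%:R g = +oo%E.
Proof.
rewrite negb_or mulf_eq0 negb_or => c0 g0 cK /andP[/andP[cn0 gn0]].
rewrite (negPf cn0) /= -leqNgt in cK * => K1.
have -> : K = 1%N by lia.
rewrite /bound_summand /neg_log_term (negPf gn0) subrr eqxx addey//.
by rewrite gt0_muley// lte_fin lt_neqAle eq_sym cn0.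
Qed.

(** This ensures that a sum whose other summand is [+oo] is itself [+oo]. *)
Lemma bound_summand_neq_ninfty (q : nat) (c m g : R) : 0 <= c ->
  bound_summand q c m g != -oo%E.
Proof.
rewrite /bound_summand /neg_log_term => c0.
case: (g == 0); first by rewrite adde0.
case: (m - 1 == 0) => //; rewrite addey//.
by move: c0; rewrite le_eqVlt => /predU1P[<-|c0]; rewrite ?mul0e// gt0_muley.
Qed.

Lemma ceil_div_itv (x p : nat) : (0 < p)%N ->
  (x <= (x + p.-1) %/ p * p < x + p)%N.
Proof.
move=> p0; have := divn_eq (x + p.-1) p; have := ltn_pmod (x + p.-1) p0.
by set t := (_ %/ p * p)%N; set r := (_ %% p)%N; lia.
Qed.

Lemma rate_bound (T : finType) (gamma delta alpha g0 g1 rate : R) (dn : nat)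
    (F : code_family T) :
  let q := #|T| in
  let c0 := alpha * ((q - dn)%:R / q%:R) in
  let c1 := (1 - alpha) * ((q - dn - 1)%N%:R / q%:R) in
  (1 < q)%N -> (dn < q)%N -> 0 <= alpha <= 1 -> delta * q%:R = dn%:R + (1 - alpha) ->
  0 <= g0 -> 0 <= g1 -> c0 * g0 + c1 * g1 <= gamma ->
  (c0 * g0 == 0) || (1 < q - dn)%N -> (c1 * g1 == 0) || (1 < q - dn - 1)%N ->
  family_list_decodable gamma delta F -> is_rate F rate ->
  rate * ln q%:R
  + c0 * ((1 + g0) * ln (1 + g0) - g0 * ln g0
      + g0 * ln (q - dn).-1%:R - (1 + g0) * ln (q - dn)%:R)
  + c1 * ((1 + g1) * ln (1 + g1) - g1 * ln g1
      + g1 * ln (q - dn - 1).-1%:R - (1 + g1) * ln (q - dn - 1)%N%:R) <= 0.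
Proof.
move=> q c0 c1 q1 dq /andP[al0 al1] edelta g00 g10 hg h0 h1 [L FL] hrate.
have q0 : (0 < q)%N by lia.
have qR0 : 0 < q%:R :> R by rewrite ltr0n.
have c00 : 0 <= c0 by rewrite !mulr_ge0// invr_ge0.
have c10 : 0 <= c1 by rewrite !mulr_ge0 ?invr_ge0//; lra.
(* The index is shifted because the first block length may be [0]. *)
pose n k := block_length F k.+1.
have nk k : (k < n k)%N.
  rewrite /n; elim: k => [|k IH]; first exact: leq_ltn_trans (block_length_incr F (ltnSn 0)).
  exact: leq_ltn_trans IH (block_length_incr F (ltnSn _)).
have n_gt0 k : (0 < n k)%N by exact: leq_ltn_trans (nk k).
have n_oo : (n k)%:R^-1 @[k --> \oo] --> (0 : R).
  apply: squeeze_cvgr (cvg_cst 0) cvg_harmonic; near=> k.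
  by rewrite invr_ge0 ler0n /= lef_pV2 ?posrE ?ltr0n// ler_nat.
(* The second block is rounded down and the kept lengths [l0], [l1] are rounded up, so rounding
   never costs extra deletions; the numbers of insertions are rounded down. *)
pose b k := Num.truncn ((1 - alpha) * (n k)%:R).
have bR k : (b k)%:R <= (1 - alpha) * (n k)%:R :> R.
  by rewrite truncn_le mulr_ge0//; lra.
have bn k : (b k <= n k)%N.
  by rewrite -(ler_nat R) (le_trans (bR k))// ler_piMl//; lra.
pose a k := (n k - b k)%N.
pose l0 k := ((a k * (q - dn) + q.-1) %/ q)%N.
pose l1 k := ((b k * (q - dn - 1) + q.-1) %/ q)%N.
pose i0 k := Num.truncn (c0 * g0 * (n k)%:R).
pose i1 k := Num.truncn (c1 * g1 * (n k)%:R).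
have cg0 : 0 <= c0 * g0 by rewrite mulr_ge0.
have cg1 : 0 <= c1 * g1 by rewrite mulr_ge0.
have bc : (b k)%:R / (n k)%:R @[k --> \oo] --> (1 - alpha).
  by apply: cvg_truncn => //; lra.
have ac : (a k)%:R / (n k)%:R @[k --> \oo] --> alpha.
  rewrite -[alpha](subKr 1); under eq_fun => k.
    rewrite natrB// mulrBl divff ?pnatr_eq0 -?lt0n//; over.
  by apply: cvgB => //; exact: cvg_cst.
have i0c := cvg_truncn n_gt0 n_oo cg0.
have i1c := cvg_truncn n_gt0 n_oo cg1.
have l0c := cvg_ceil_div n_gt0 n_oo (j := (q - dn)%N) q0 ac.
have l1c := cvg_ceil_div n_gt0 n_oo (j := (q - dn - 1)%N) q0 bc.
have p0 k : (0 < (q - dn).-1)%N || (i0 k == 0)%N.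
  case/orP: h0 => [/eqP h|h]; last by apply/orP; left; lia.
  by rewrite /i0 h mul0r truncn0 eqxx orbT.
have p1 k : (0 < (q - dn - 1).-1)%N || (i1 k == 0)%N.
  case/orP: h1 => [/eqP h|h]; last by apply/orP; left; lia.
  by rewrite /i1 h mul0r truncn0 eqxx orbT.
have [f0 f0c f0le] := superword_rate n_gt0 n_oo (q - dn)%N l0c i0c c00 g00 p0.
have [f1 f1c f1le] := superword_rate n_gt0 n_oo (q - dn - 1)%N l1c i1c c10 g10 p1.
have [fL fLc fLle] := ln_poly_rate n_gt0 n_oo L.
pose u k : R := logb q #|Defs.code F k.+1|%:R / (n k)%:R.
have uc : u k @[k --> \oo] --> rate.
  have := hrate; rewrite /is_rate -/q -cvg_shiftS; exact.
(* The inequality of [ln_size_bound], divided by the block length, passes to the limit; its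
   right-hand side tends to [0]. *)
apply: (@ler_cvg_to _ \oo _ _ (fun k => u k * ln q%:R + f0 k + f1 k)
  (fun k => (q + q)%:R * ln 2 * (n k)%:R^-1 + fL k)).
- by apply: cvgD f1c; apply: cvgD f0c; apply: cvgM uc _; exact: cvg_cst.
- rewrite -[X in _ --> X](addr0 0) -{1}(mulr0 ((q + q)%:R * ln 2)).
  by apply: cvgD fLc; apply: cvgM n_oo; exact: cvg_cst.
near=> k.
have nR : 0 < (n k)%:R :> R by rewrite ltr0n.
have lnq : 0 < ln q%:R :> R by rewrite ln_gt0// ltr1n.
rewrite -(ler_pM2l nR) !mulrDr.
have -> : (n k)%:R * (u k * ln q%:R) = ln #|Defs.code F k.+1|%:R.
  by rewrite /u /logb; field; rewrite !gt_eqF.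
have -> : (n k)%:R * ((q + q)%:R * ln 2 * (n k)%:R^-1) = (q + q)%:R * ln 2 :> R.
  by field; rewrite gt_eqF.
apply: le_trans (_ : (q + q)%:R * ln 2 + ln (Num.max 1 L.[(n k)%:R]) <= _); last first.
  by rewrite lerD2l.
apply: le_trans (_ : ln #|Defs.code F k.+1|%:R
  + ln_superword_prob (l0 k) (i0 k) (q - dn).-1 (q - dn)%N
  + ln_superword_prob (l1 k) (i1 k) (q - dn - 1).-1 (q - dn - 1)%N <= _).
  by apply: lerD (f1le k); rewrite lerD2l; exact: f0le.
apply: (@ln_size_bound T (n k) (a k) _ _ _ _ _ _ gamma delta) => //.
- exact: FL.
- exact: leq_subr.
- exact: leq_subr.
- by rewrite -subnDA leq_subr.
- by case/andP: (ceil_div_itv (a k * (q - dn)) q0).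
- by rewrite subKn//; case/andP: (ceil_div_itv (b k * (q - dn - 1)) q0).
- apply: le_trans (ler_wpM2r (ler0n _ _) hg); rewrite natrD mulrDl.
  by apply: lerD; rewrite truncn_le mulr_ge0.
(* If [l0 + l1] exceeds [n], the truncated difference is [0]. Otherwise [q * (n - l0 - l1)] is at
   most [dn * n + b], hence at most [delta * q * n]. *)
- have [le|/ltnW] := leqP (l0 k + l1 k) (n k); last first.
    rewrite -subn_eq0 => /eqP ->; rewrite mulr_ge0//.
    by rewrite -(pmulr_lge0 _ qR0) edelta addr_ge0//; lra.
  rewrite natrB// -(ler_pM2r qR0) mulrAC edelta.
  have E0 : (a k)%:R * (q%:R - dn%:R) <= (l0 k)%:R * q%:R :> R.
    rewrite -[q%:R - dn%:R]natrB 1?ltnW// -!natrM ler_nat.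
    by case/andP: (ceil_div_itv (a k * (q - dn)) q0).
  have E1 : (b k)%:R * (q%:R - dn%:R - 1) <= (l1 k)%:R * q%:R :> R.
    have -> : q%:R - dn%:R - 1 = (q - dn - 1)%N%:R :> R.
      by rewrite [RHS]natrB ?subn_gt0// natrB// ltnW.
    rewrite -!natrM ler_nat.
    by case/andP: (ceil_div_itv (b k * (q - dn - 1)) q0).
  rewrite natrB// in E0; have := bR k; rewrite natrD; nra.
- by rewrite subn_gt0 dq.
(* With an empty second alphabet the ceiling [l1] is [q.-1 %/ q = 0], and [c1 = 0] gives
   [i1 = 0]. *)
- have [e|//] := posnP (q - dn - 1)%N.
  by rewrite /l1 /i1 /c1 e muln0 divn_small ?prednK// !mul0r mulr0 !mul0r truncn0.
Unshelve. all: by end_near. Qed.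

End Bound.

Theorem theorem2p6 (R : realType) (q : nat) (hq : (2 <= q)%N)
    (Sigma : finType) (hSigma : #|Sigma| = q)
    (gamma delta : R)
    (hgamma : 0 <= gamma <= q%:R - 1)
    (hdelta : 0 <= delta <= 1 - q%:R^-1)
    (F : code_family Sigma)
    (hF : family_list_decodable gamma delta F)
    (rate : R) (hrate : is_rate F rate) :
  let d : R := (Num.floor (delta * q%:R))%:~R in
  let alpha : R := 1 - delta * q%:R + d in
  forall gamma0 gamma1 : R, 0 <= gamma0 -> 0 <= gamma1 ->
    alpha * (1 - d / q%:R) * gamma0
      + (1 - alpha) * (1 - (d + 1) / q%:R) * gamma1 = gamma ->
    (rate%:E <=
      bound_summand q (alpha * (1 - d / q%:R)) (q%:R - d) gamma0
      + bound_summand q ((1 - alpha) * (1 - (d + 1) / q%:R))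
          (q%:R - d - 1) gamma1)%E.
Proof.
move=> d alpha g0 g1 g00 g10 hg.
have qR0 : 0 < q%:R :> R by rewrite ltr0n; lia.
case/andP: hdelta => de0 de1.
have dq0 : 0 <= delta * q%:R by rewrite mulr_ge0// ltW.
have dq1 : delta * q%:R <= q%:R - 1.
  by have := ler_wpM2r (ltW qR0) de1; rewrite mulrBl mulVf ?gt_eqF// mul1r.
have [dn ed] : exists dn : nat, d = dn%:R.
  exists (Num.truncn (delta * q%:R)).
  by rewrite /d truncn_floor dq0 natr_absz ger0_norm// floor_ge0.
have dle : d <= delta * q%:R by exact: floor_le.
have dlt : delta * q%:R < d + 1 by have := floorD1_gt (delta * q%:R); rewrite intrD.
have al0 : 0 < alpha by rewrite /alpha; lra.
have al1 : alpha <= 1 by rewrite /alpha; lra.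
have dnq : (dn < q)%N by rewrite -(ltr_nat R) -ed; lra.
have K0 : q%:R - d = (q - dn)%:R by rewrite ed natrB// ltnW.
have K1 : q%:R - d - 1 = (q - dn - 1)%N%:R by rewrite K0 [RHS]natrB ?subn_gt0.
have C0 : 1 - d / q%:R = (q - dn)%:R / q%:R by rewrite -K0; field; rewrite gt_eqF.
have C1 : 1 - (d + 1) / q%:R = (q - dn - 1)%N%:R / q%:R.
  by rewrite -K1; field; rewrite gt_eqF.
rewrite K1 K0 C0 C1 in hg *.
set c0 := alpha * _ in hg *; set c1 := (1 - alpha) * _ in hg *.
have c00 : 0 <= c0 by rewrite !mulr_ge0 ?invr_ge0// ltW.
have c10 : 0 <= c1 by rewrite !mulr_ge0 ?invr_ge0 ?subr_ge0// ltW.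
have n0 : (c0 == 0) || (0 < q - dn)%N by rewrite subn_gt0 dnq orbT.
have n1 : (c1 == 0) || (0 < q - dn - 1)%N.
  by have [e|] := posnP (q - dn - 1); rewrite ?orbT// /c1 e mul0r mulr0 eqxx.
(* A positive amount of insertions into a block that keeps a single letter makes the right-hand side
   [+oo]; only the finite case calls for [rate_bound]. *)
have [h0|h0] := boolP ((c0 * g0 == 0) || (1 < q - dn)%N); last first.
  by rewrite (bound_summand_pinfty q c00 g00 n0 h0) addye ?leey ?bound_summand_neq_ninfty.
have [h1|h1] := boolP ((c1 * g1 == 0) || (1 < q - dn - 1)%N); last first.
  by rewrite (bound_summand_pinfty q c10 g10 n1 h1) addey ?leey ?bound_summand_neq_ninfty.
rewrite !bound_summandE// -EFinD lee_fin -mulrDl ler_pdivlMr ?ln_gt0 ?ltr1n//.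
have ede : delta * q%:R = dn%:R + (1 - alpha) by rewrite /alpha ed; ring.
have := @rate_bound R Sigma gamma delta alpha g0 g1 rate dn F.
have al : 0 <= alpha <= 1 by rewrite (ltW al0).
have hle : c0 * g0 + c1 * g1 <= gamma by rewrite hg.
rewrite hSigma => /(_ hq dnq al ede g00 g10 hle h0 h1 hF hrate) /=.
by rewrite -/c0 -/c1; lra.
Qed.
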